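(* Let $G$ be a finitely generated group, $S$ a finite generating set of $G$, and $\varphi:G\times X\to X$ a continuous action on a compact metric space $(X,d)$. (1) A point $p\in X$ is persistent shadowable for $\varphi$ if and only if for every $\epsilon>0$ there is $\delta>0$ such that for every continuous action $\psi:G\times X\to X$ with $d_S(\varphi,\psi)<\delta$, every $\delta$-pseudo orbit $f:G\to X$ of $\psi$ with $f(e)\in B[p,\delta]$ can be $\epsilon$-shadowed by a $\psi$-orbit. (2) For a compact set $K\subseteq X$, $\varphi$ has the persistent shadowing property on $K$ if and only if $K\subseteq PSh(\varphi)$. (3) $\varphi$ has the persistent shadowing property if and only if it is pointwise persistent shadowable. (4) $PSh(\varphi)=UPersis_\beta(\varphi)\cap Sh(\varphi)$. (5) $\varphi$ has the persistent shadowing property if and only if it is $\beta$-persistent and has the shadowing property.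
   Context: $G$ has the discrete topology. $B[p,\delta]$ is the closed and $B_\delta(p)$ the open ball of radius $\delta$ about $p$. For continuous actions $\varphi,\psi$ of $G$ on $X$ put $d_S(\varphi,\psi)=\sup\{d(\varphi(s,x),\psi(s,x)): x\in X, s\in S\}$. A map $f:G\to X$ is a $\delta$-pseudo orbit of $\psi$ if $d(f(sg),\psi(s,f(g)))<\delta$ for all $s\in S$, $g\in G$. It is $\epsilon$-shadowed by the $\psi$-orbit of $z\in X$ (or $(\psi,\epsilon)$-shadowed by $z$) if $d(f(g),\psi(g,z))<\epsilon$ for all $g\in G$. Shadowing property: for every $\epsilon>0$ there is $\delta>0$ such that every $\delta$-pseudo orbit of $\varphi$ is $(\varphi,\epsilon)$-shadowed by a point of $X$. Persistent shadowing property on $K\subseteq X$: for every $\epsilon>0$ there is $\delta>0$ such that for every continuous action $\psi:G\times X\to X$ with $d_S(\varphi,\psi)<\delta$, every $\delta$-pseudo orbit $f$ of $\psi$ with $f(e)\in K$ is $(\psi,\epsilon)$-shadowed by a point of $X$. Persistent shadowing property: the case $K=X$. $\beta$-persistent: for every $\epsilon>0$ there is $\delta>0$ such that for every $x\in X$ and every continuous action $\psi:G\times X\to X$ with $d_S(\varphi,\psi)<\delta$ there is $y\in X$ with $d(\varphi(g,x),\psi(g,y))<\epsilon$ for all $g\in G$. $Sh(\varphi)$: the set of shadowable points, i.e. $x\in X$ such that for every $\epsilon>0$ there is $\delta>0$ such that every $\delta$-pseudo orbit $f$ of $\varphi$ with $f(e)=x$ is $(\varphi,\epsilon)$-shadowed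 by a point of $X$. $PSh(\varphi)$: the set of persistent shadowable points, i.e. $x\in X$ such that for every $\epsilon>0$ there is $\delta>0$ such that for every continuous action $\psi:G\times X\to X$ with $d_S(\varphi,\psi)<\delta$, every $\delta$-pseudo orbit $f$ of $\psi$ with $f(e)=x$ is $(\psi,\epsilon)$-shadowed by a point of $X$. $\varphi$ is pointwise persistent shadowable if $PSh(\varphi)=X$. $UPersis_\beta(\varphi)$: the set of uniformly $\beta$-persistent points, i.e. $x\in X$ such that for every $\epsilon>0$ there is $\delta>0$ such that for every continuous action $\psi:G\times X\to X$ with $d_S(\varphi,\psi)<\delta$ and every $x'\in B_\delta(x)$ there is $y\in X$ with $d(\varphi(g,x'),\psi(g,y))<\epsilon$ for all $g\in G$. *)

(* Defs.v *)
From HB Require Import structures.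
From mathcomp Require Import all_boot all_order all_algebra.
From mathcomp Require Import all_classical all_reals all_analysis.

Set Implicit Arguments.
Unset Strict Implicit.
Unset Printing Implicit Defensive.

Import Order.TTheory GRing.Theory Num.Theory.

Local Open Scope classical_set_scope.
Local Open Scope ring_scope.

(* The only subgroup of G containing S is G itself; S need not be symmetric. *)
Definition generates (G : groupType) (S : set G) : Prop :=
  forall H : {pred G},
    group_closed H -> (forall s, S s -> s \in H) -> forall g, g \in H.

(* [discrete_topology G] is G with the discrete topology, so [act_continuous]
   is joint continuity on the product space G x X. *)
Record cont_action (G : groupType) (X : topologicalType) := ContAction {
  act_fun :> G -> X -> X ;
  act_one : forall x, act_fun 1%g x = x ;
  act_mul : forall g h x, act_fun (g * h)%g x = act_fun g (act_fun h x) ;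
  act_continuous :
    continuous (fun gx : discrete_topology G * X => act_fun gx.1 gx.2)
}.

Section Shadowing.
Context {R : realType} {G : groupType} {X : metricType R}.
Implicit Types (S : set G) (phi psi : cont_action G X) (K : set X).
Implicit Types (f : G -> X) (eps delta : R).

(* [closed_ball] in the library is the closure of the open ball, which can be
   smaller than the following set. *)
Definition cball (p : X) delta : set X := [set x | mdist p x <= delta].

(* The supremum is taken in the extended reals, where it always exists
   (it is -oo when S or X is empty). *)
Definition act_dist S phi psi : \bar R :=
  ereal_sup [set (mdist (phi s x) (psi s x))%:E | s in S & x in [set: X]].

Definition pseudo_orbit S psi delta f : Prop :=
  forall s g, S s -> mdist (f (s * g)%g) (psi s (f g)) < delta.

Definition shadowed_by psi eps f (z : X) : Prop :=
  forall g, mdist (f g) (psi g z) < eps.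

Definition shadowing S phi : Prop :=
  forall eps, 0 < eps -> exists delta, 0 < delta /\
    forall f, pseudo_orbit S phi delta f -> exists z, shadowed_by phi eps f z.

Definition persistent_shadowing_on S phi K : Prop :=
  forall eps, 0 < eps -> exists delta, 0 < delta /\
    forall psi, (act_dist S phi psi < delta%:E)%E ->
    forall f, pseudo_orbit S psi delta f -> K (f 1%g) ->
    exists z, shadowed_by psi eps f z.

Definition persistent_shadowing S phi : Prop :=
  persistent_shadowing_on S phi [set: X].

Definition beta_persistent S phi : Prop :=
  forall eps, 0 < eps -> exists delta, 0 < delta /\
    forall (x : X) psi, (act_dist S phi psi < delta%:E)%E ->
    exists y, forall g, mdist (phi g x) (psi g y) < eps.

Definition Sh S phi : set X :=
  [set x | forall eps, 0 < eps -> exists delta, 0 < delta /\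
    forall f, pseudo_orbit S phi delta f -> f 1%g = x ->
    exists z, shadowed_by phi eps f z].

Definition PSh S phi : set X :=
  [set x | forall eps, 0 < eps -> exists delta, 0 < delta /\
    forall psi, (act_dist S phi psi < delta%:E)%E ->
    forall f, pseudo_orbit S psi delta f -> f 1%g = x ->
    exists z, shadowed_by psi eps f z].

Definition pointwise_persistent_shadowable S phi : Prop :=
  PSh S phi = [set: X].

Definition UPersis_beta S phi : set X :=
  [set x | forall eps, 0 < eps -> exists delta, 0 < delta /\
    forall psi, (act_dist S phi psi < delta%:E)%E ->
    forall x', ball x delta x' ->
    exists y, forall g, mdist (phi g x') (psi g y) < eps].

End Shadowing.

(* Main.v *)
Require Import Defs.
From HB Require Import structures.
From mathcomp Require Import all_boot all_order all_algebra.
From mathcomp Require Import all_classical all_reals all_analysis.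
From mathcomp Require Import lra.

Import Order.TTheory GRing.Theory Num.Theory.

Local Open Scope classical_set_scope.
Local Open Scope ring_scope.

(** The mathematical content is in two transfer principles, for pseudo-orbits
    and for shadowing, which rest on the triangle inequality and on the
    continuity of the generators at one point.

    Pseudo-orbits do not see small changes.  If [psi] is [delta1]-close to
    [phi] on the generators, a [delta2]-pseudo-orbit of [psi] is a
    [delta1 + delta2]-pseudo-orbit of [phi] ([pseudo_orbit_perturb]); in
    particular every true orbit of [phi] is a pseudo-orbit of [psi]
    ([orbit_pseudo_orbit]).  Also, moving the single value [f 1] of a
    pseudo-orbit to a nearby point [p] leaves a pseudo-orbit, with an error
    governed by the moduli of continuity at [p] of the finitely many maps
    [phi s] ([rebase_pseudo_orbit]).  The error does not involve the modulus of
    [psi], which is why one [delta] serves all perturbations at once.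

    Shadowing relations compose: if a [phi]-orbit shadows [f] and a [psi]-orbit
    follows that [phi]-orbit, then the [psi]-orbit shadows [f]
    ([shadowed_by_follow]).

    Rebasing turns persistent shadowability at [p] into the same property,
    uniformly over pseudo-orbits starting near [p] ([PSh_cball]).  Compactness
    makes these local constants uniform over a set of persistent shadowable
    points ([compact_persistent_shadowing_on]).

    For the decomposition into persistence and shadowing, one direction takes
    [psi = phi] to get shadowing, and uses that orbits of [phi] are
    pseudo-orbits of [psi] to get that they are followed.  Conversely a
    pseudo-orbit of [psi] is one of [phi], hence shadowed by a [phi]-orbit,
    which is in turn followed by a [psi]-orbit.  In the pointwise version the
    shadowing point is only known to be close to the base point, which is
    exactly what uniformity in [UPersis_beta] absorbs. *)

Section PersistentShadowing.
Set Implicit Arguments.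
Unset Strict Implicit.

Context {R : realType} {G : groupType} {X : metricType R}.
Implicit Types (S : set G) (phi psi : cont_action G X) (K : set X).
Implicit Types (f : G -> X) (eps delta : R) (p x y z : X).

(** * Distance between actions and transfer of pseudo-orbits *)

Lemma act_dist_ltP S phi psi delta s x :
  (act_dist S phi psi < delta%:E)%E -> S s ->
  mdist (phi s x) (psi s x) < delta.
Proof.
move=> close Ss; rewrite -lte_fin; apply: le_lt_trans close.
by apply/ereal_sup_ubound; exists s => //; exists x.
Qed.

Lemma act_dist_self S phi delta :
  0 < delta -> (act_dist S phi phi < delta%:E)%E.
Proof.
move=> delta_gt0; apply: (@le_lt_trans _ _ 0%E); last by rewrite lte_fin.
by apply: ge_ereal_sup => _ [s _ [x _ <-]]; rewrite mdistxx.
Qed.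

Lemma act_dist_ltW S phi psi delta delta' :
  delta <= delta' ->
  (act_dist S phi psi < delta%:E)%E -> (act_dist S phi psi < delta'%:E)%E.
Proof. by move=> le_d /lt_le_trans; apply; rewrite lee_fin. Qed.

Lemma pseudo_orbitW S psi delta delta' f :
  delta <= delta' -> pseudo_orbit S psi delta f -> pseudo_orbit S psi delta' f.
Proof. by move=> le_d fP s g Ss; apply: lt_le_trans (fP s g Ss) le_d. Qed.

Lemma pseudo_orbit_perturb S phi psi delta1 delta2 f :
  (act_dist S phi psi < delta1%:E)%E -> pseudo_orbit S psi delta2 f ->
  pseudo_orbit S phi (delta1 + delta2) f.
Proof.
move=> close fP s g Ss.
have := metric_triangle (f (s * g)%g) (psi s (f g)) (phi s (f g)).
have := fP s g Ss; have := act_dist_ltP (f g) close Ss.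
rewrite (metric_sym (phi s (f g))); lra.
Qed.

Lemma orbit_pseudo_orbit S phi psi delta x :
  (act_dist S phi psi < delta%:E)%E -> pseudo_orbit S psi delta (phi^~ x).
Proof.
by move=> close s g Ss; rewrite act_mul; exact: act_dist_ltP close Ss.
Qed.

Lemma shadowed_by_follow phi psi eps1 eps2 f z y :
  shadowed_by phi eps1 f z ->
  (forall g, mdist (phi g z) (psi g y) < eps2) ->
  shadowed_by psi (eps1 + eps2) f y.
Proof.
move=> fz zy g; apply: le_lt_trans (metric_triangle _ (phi g z) _) _.
by apply: ltrD.
Qed.

(** * Changing the base point of a pseudo-orbit *)

Lemma act_continuous_pt phi s : continuous (phi s).
Proof.
move=> x; pose i y : discrete_topology G * X := (s, y).
apply: (@continuous_comp _ _ _ i (fun gx => phi gx.1 gx.2)).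
  apply: (@cvg_pair _ (discrete_topology G) _ _ (nbhs (s : discrete_topology G))
            _ _ _ _ (fun=> s) id).
    exact: (@cvg_cst (discrete_topology G)).
  exact: cvg_id.
exact: act_continuous.
Qed.

Lemma generators_equicontinuous S phi p eps : finite_set S -> 0 < eps ->
  exists delta, 0 < delta /\ forall s x, S s -> mdist p x < delta ->
    mdist (phi s p) (phi s x) < eps.
Proof.
move=> /finite_fsetP[F SF] eps_gt0.
have : nbhs p (\bigcap_(s in S) [set x | mdist (phi s p) (phi s x) < eps]).
  rewrite SF; apply: filter_bigI => s _.
  have /(_ (ball (phi s p) eps)) := @act_continuous_pt phi s p.
  by move=> /(_ (nbhsx_ballx _ _ eps_gt0)); rewrite ballEmdist.
move=> /nbhs_ballP[delta delta_gt0]; rewrite ballEmdist => sub.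
exists delta; split=> // s x Ss px; exact: sub px s Ss.
Qed.

Definition rebase f p : G -> X := fun g => if g == 1%g then p else f g.

(** The pairs [(g, s * g)] affected by the change at [1] are those with
    [g = 1], where [psi s] is compared at [f 1] and at [p] by passing through
    [phi s], and those with [s * g = 1], where the target moves by [delta]. *)
Lemma rebase_pseudo_orbit S phi psi delta eta p f :
  0 < delta -> 0 < eta -> (act_dist S phi psi < delta%:E)%E ->
  pseudo_orbit S psi delta f -> cball p delta (f 1%g) ->
  (forall s, S s -> mdist (phi s p) (phi s (f 1%g)) < eta) ->
  pseudo_orbit S psi (3 * delta + eta) (rebase f p).
Proof.
rewrite /cball /= => delta_gt0 eta_gt0 close fP pf1 equi s g Ss.
rewrite /rebase; have [->|g_neq1] := eqVneq g 1%g.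
  rewrite mulg1; have [->|s_neq1] := eqVneq s 1%g.
    by rewrite act_one mdistxx; lra.
  have := fP s 1%g Ss; rewrite mulg1.
  have := act_dist_ltP (f 1%g) close Ss; have := act_dist_ltP p close Ss.
  have := equi s Ss.
  have := metric_triangle (f s) (psi s (f 1%g)) (psi s p).
  have := metric_triangle (psi s (f 1%g)) (phi s (f 1%g)) (psi s p).
  have := metric_triangle (phi s (f 1%g)) (phi s p) (psi s p).
  rewrite (metric_sym (psi s (f 1%g)) (phi s _)).
  rewrite (metric_sym (phi s (f 1%g)) (phi s p)); lra.
have := fP s g Ss; have [->|_] := eqVneq (s * g)%g 1%g; last by lra.
have := metric_triangle p (f 1%g) (psi s (f g)); lra.
Qed.

(** A pseudo-orbit starting near [p] and its rebased copy differ only at [1],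
    so a point that shadows the copy also shadows the original, up to the
    distance from [f 1] to [p]. *)
Lemma PSh_cball S phi p : finite_set S -> PSh S phi p ->
  forall eps, 0 < eps -> exists delta, 0 < delta /\
    forall psi, (act_dist S phi psi < delta%:E)%E ->
    forall f, pseudo_orbit S psi delta f -> cball p delta (f 1%g) ->
    exists z, shadowed_by psi eps f z.
Proof.
move=> finS pP eps eps_gt0.
have [|d0 [d0_gt0 d0P]] := pP (eps / 2); first by lra.
have [|d1 [d1_gt0 d1P]] :=
  @generators_equicontinuous S phi p (d0 / 2) finS; first by lra.
(* [d0 / 6] makes the error [3 * delta + d0 / 2] of the rebased map at most
   [d0]; [eps / 2] pays for moving the value at 1 back. *)
pose delta := Num.min (d0 / 6) (Num.min (d1 / 2) (eps / 2)).
have [ded0 ded1 dee] :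
    [/\ delta <= d0 / 6, delta <= d1 / 2 & delta <= eps / 2].
  by split; rewrite /delta !ge_min lexx ?orbT.
have delta_gt0 : 0 < delta by rewrite /delta !lt_min; apply/and3P; split; lra.
exists delta; split=> // psi close f fP pf1.
have [|||z zP] := d0P psi _ (rebase f p).
- by apply: act_dist_ltW close; lra.
- apply: (@pseudo_orbitW _ _ (3 * delta + d0 / 2)); first by lra.
  apply: (rebase_pseudo_orbit (phi := phi)) => //; first by lra.
  by move=> s Ss; apply: d1P => //; apply: le_lt_trans pf1 _; lra.
- by rewrite /rebase eqxx.
exists z => g; have := zP g; rewrite /rebase.
have [->|_] /= := eqVneq g 1%g; last by lra.
have := metric_triangle (f 1%g) p (psi 1%g z); move: pf1.
rewrite /cball /= (metric_sym p (f 1%g)); lra.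
Qed.

(** * Persistent shadowing on compact sets *)

(** Uniformity in a ball around each point of [K] is exactly the input of the
    covering form of compactness, with [delta] tending to [0] from above as the
    parameter. *)
Lemma compact_persistent_shadowing_on S phi K :
  finite_set S -> compact K ->
  K `<=` PSh S phi -> persistent_shadowing_on S phi K.
Proof.
move=> finS /compact_near_coveringP cover KP eps eps_gt0.
pose P delta x := forall psi, (act_dist S phi psi < delta%:E)%E ->
  forall f, pseudo_orbit S psi delta f -> f 1%g = x ->
  exists z, shadowed_by psi eps f z.
have unif : \forall delta \near 0^'+, K `<=` P delta.
  apply: cover => p Kp.
  have [d [d_gt0 dP]] := PSh_cball finS (KP p Kp) eps_gt0.
  exists (ball p d, [set delta | delta < d]) => /=.
    by split; [exact: nbhsx_ballx | exact: nbhs_right_lt].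
  move=> [x delta] /= []; rewrite ballEmdist /= => px /ltW le_d psi close f fP f1.
  apply: dP (act_dist_ltW le_d close) _ (pseudo_orbitW le_d fP) _.
  by rewrite /cball /= f1 ltW.
have [delta [delta_gt0 deltaP]] : exists delta, 0 < delta /\ K `<=` P delta.
  near (0:R)^'+ => delta; exists delta; split; near: delta => //.
  exact: nbhs_right_gt.
exists delta; split=> // psi close f fP Kf1.
exact: deltaP Kf1 psi close f fP erefl.
Unshelve. all: by end_near. Qed.

Lemma persistent_shadowing_on_PSh S phi K :
  persistent_shadowing_on S phi K -> K `<=` PSh S phi.
Proof.
move=> shK p Kp eps /shK[delta [delta_gt0 deltaP]]; exists delta; split=> //.
by move=> psi close f fP f1; apply: (deltaP psi close f fP); rewrite f1.
Qed.

(** * Persistence together with shadowing *)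

Lemma PSh_Sh S phi : PSh S phi `<=` Sh S phi.
Proof.
move=> p pP eps /pP[delta [delta_gt0 deltaP]]; exists delta; split=> //.
exact: deltaP (act_dist_self S phi delta_gt0).
Qed.

Lemma PSh_UPersis_beta S phi :
  finite_set S -> PSh S phi `<=` UPersis_beta S phi.
Proof.
move=> finS p pP eps /(PSh_cball finS pP)[delta [delta_gt0 deltaP]].
exists delta; split=> // psi close x; rewrite ballEmdist /= => px.
apply: deltaP close _ (orbit_pseudo_orbit x close) _.
by rewrite /cball /= act_one ltW.
Qed.

(** The tolerance for shadowing in [phi] is chosen below the radius supplied by
    [UPersis_beta], so that the shadowing point falls in the ball where orbits
    of [phi] are followed uniformly. *)
Lemma UPersis_beta_Sh_PSh S phi :
  UPersis_beta S phi `&` Sh S phi `<=` PSh S phi.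
Proof.
move=> p [pU pS] eps eps_gt0.
have [|d0 [d0_gt0 d0P]] := pU (eps / 2); first by lra.
pose eps1 := Num.min d0 (eps / 2).
have [eps1d eps1e] : eps1 <= d0 /\ eps1 <= eps / 2.
  by rewrite /eps1 !ge_min !lexx orbT.
have [|d1 [d1_gt0 d1P]] := pS eps1.
  by rewrite /eps1 lt_min; apply/andP; split; lra.
pose delta := Num.min d0 (d1 / 2).
have [ded0 ded1] : delta <= d0 /\ delta <= d1 / 2.
  by rewrite /delta !ge_min !lexx orbT.
exists delta; split; first by rewrite /delta lt_min; apply/andP; split; lra.
move=> psi close f fP f1.
have [|z fz] := d1P f _ f1.
  apply: pseudo_orbitW (pseudo_orbit_perturb close fP); lra.
have [|y zy] := d0P psi (act_dist_ltW ded0 close) z.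
  rewrite ballEmdist /=; have := fz 1%g; rewrite act_one f1; lra.
exists y => g; apply: lt_le_trans (shadowed_by_follow fz zy g) _; lra.
Qed.

Lemma persistent_shadowing_shadowing S phi :
  persistent_shadowing S phi -> shadowing S phi.
Proof.
move=> sh eps /sh[delta [delta_gt0 deltaP]]; exists delta; split=> // f fP.
exact: deltaP (act_dist_self S phi delta_gt0) f fP I.
Qed.

Lemma persistent_shadowing_beta_persistent S phi :
  persistent_shadowing S phi -> beta_persistent S phi.
Proof.
move=> sh eps /sh[delta [delta_gt0 deltaP]]; exists delta.
split=> // x psi close.
exact: deltaP close _ (orbit_pseudo_orbit x close) I.
Qed.

Lemma beta_persistent_shadowing_persistent S phi :
  beta_persistent S phi -> shadowing S phi -> persistent_shadowing S phi.
Proof.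
move=> beta sh eps eps_gt0.
have [|d0 [d0_gt0 d0P]] := beta (eps / 2); first by lra.
have [|d1 [d1_gt0 d1P]] := sh (eps / 2); first by lra.
pose delta := Num.min d0 (d1 / 2).
have [ded0 ded1] : delta <= d0 /\ delta <= d1 / 2.
  by rewrite /delta !ge_min !lexx orbT.
exists delta; split; first by rewrite /delta lt_min; apply/andP; split; lra.
move=> psi close f fP _.
have [|z fz] := d1P f.
  apply: pseudo_orbitW (pseudo_orbit_perturb close fP); lra.
have [y zy] := d0P z psi (act_dist_ltW ded0 close).
exists y => g; apply: lt_le_trans (shadowed_by_follow fz zy g) _; lra.
Qed.

End PersistentShadowing.

Theorem theorem3p6 (R : realType) (G : groupType) (S : set G)
    (S_finite : finite_set S) (S_gen : generates S)
    (X : metricType R) (X_compact : compact [set: X])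
    (phi : cont_action G X) :
  (forall p : X,
     PSh S phi p <->
     (forall eps : R, 0 < eps -> exists delta : R, 0 < delta /\
        forall psi : cont_action G X, (act_dist S phi psi < delta%:E)%E ->
        forall f : G -> X, pseudo_orbit S psi delta f ->
          cball p delta (f 1%g) ->
        exists z : X, shadowed_by psi eps f z)) /\
  (forall K : set X, compact K ->
     (persistent_shadowing_on S phi K <-> K `<=` PSh S phi)) /\
  (persistent_shadowing S phi <-> pointwise_persistent_shadowable S phi) /\
  (PSh S phi = UPersis_beta S phi `&` Sh S phi) /\
  (persistent_shadowing S phi <-> beta_persistent S phi /\ shadowing S phi).
Proof.
have onK K : compact K ->
    (persistent_shadowing_on S phi K <-> K `<=` PSh S phi).
  move=> cK; split; first exact: persistent_shadowing_on_PSh.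
  exact: compact_persistent_shadowing_on.
split=> [p|]; first split.
- exact: PSh_cball.
- move=> ball_p eps /ball_p[delta [delta_gt0 deltaP]]; exists delta.
  split=> // psi close f fP f1; apply: (deltaP psi close f fP).
  by rewrite /cball /= f1 mdistxx ltW.
split; first exact: onK.
split.
  apply: (iff_trans (onK _ X_compact)).
  rewrite /pointwise_persistent_shadowable.
  by split=> [TP|->//]; apply/seteqP.
split.
  apply/seteqP; split; last exact: UPersis_beta_Sh_PSh.
  by move=> p pP; split; [exact: PSh_UPersis_beta | exact: PSh_Sh].
split=> [sh|[beta sh]]; last exact: beta_persistent_shadowing_persistent.
split; first exact: persistent_shadowing_beta_persistent.
exact: persistent_shadowing_shadowing.
Qed.
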